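(* Let $n\ge 2$ be even, let $G=SD_{8n}$ (embedded in $S_{4n}$), and let $V$ be an $m$-dimensional complex inner product space. Let $h\in C^{\dag}_{even}$ and $h'\in C^{\dag}_{odd}$. Then $$\dim V^{4n}_{\chi_0}(G)=\frac{1}{8n}\Big[2nm^{n}+2nm^{2n+1}+\sum_{k=0}^{4n-1}m^{\gcd(4n,k)}\Big],$$ $$\dim V^{4n}_{\chi_1}(G)=\frac{1}{8n}\Big[-2nm^{n}-2nm^{2n+1}+\sum_{k=0}^{4n-1}m^{\gcd(4n,k)}\Big],$$ $$\dim V^{4n}_{\chi_2}(G)=\frac{1}{8n}\Big[m^{4n}+m^{2n}+2\sum_{k\in C^{\dag}_{even}}m^{\gcd(4n,k)}-\sum_{k\in C^{\dag}_{odd}\cup\overline{C^{\dag}_{odd}}}m^{\gcd(4n,k)}+2nm^{2n+1}-2nm^{n}\Big],$$ $$\dim V^{4n}_{\chi_3}(G)=\frac{1}{8n}\Big[m^{4n}+m^{2n}+2\sum_{k\in C^{\dag}_{even}}m^{\gcd(4n,k)}-\sum_{k\in C^{\dag}_{odd}\cup\overline{C^{\dag}_{odd}}}m^{\gcd(4n,k)}-2nm^{2n+1}+2nm^{n}\Big],$$ $$\dim V^{4n}_{\varsigma_h}(G)=\frac{1}{2n}\Big[\sum_{k=0}^{4n-1}m^{\gcd(4n,k)}\cos\Big(\frac{hk\pi}{2n}\Big)\Big],$$ $$\dim V^{4n}_{\psi_{h'}}(G)=\frac{1}{4n}\Big[m^{4n}-m^{2n}+4\sum_{k\in C^{\dag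}_{even}}m^{\gcd(4n,k)}\cos\Big(\frac{h'k\pi}{2n}\Big)\Big].$$
   Context: $SD_{8n}=\langle a,b\mid a^{4n}=b^2=1,\ bab=a^{2n-1}\rangle$ is the semi-dihedral group of order $8n$, with elements $a^k, ba^k$ ($0\le k\le 4n-1$). It is regarded as a subgroup of $S_{4n}$ (permutations of $\{1,\dots,4n\}$, identified with the residues modulo $4n$) via $a: t\mapsto t+1$ and $b:t\mapsto (2n-1)t$ modulo $4n$. For a permutation group $G\le S_{4n}$ and an irreducible complex character $\chi$ of $G$, $P_\sigma$ is the operator on $\bigotimes^{4n}V$ with $P_\sigma(v_1\otimes\cdots\otimes v_{4n})=v_{\sigma^{-1}(1)}\otimes\cdots\otimes v_{\sigma^{-1}(4n)}$, and the symmetry class of tensors $V^{4n}_\chi(G)$ is the image of $T(G,\chi)=\frac{\chi(1)}{|G|}\sum_{\sigma\in G}\chi(\sigma)P_\sigma$ on $\bigotimes^{4n}V$. For $n$ even: $C^{\dag}_{even}=\{2,4,\dots,2n-2\}$ and $C^{\dag}_{odd}=\{1,3,\dots,n-1\}\cup\{2n+1,2n+3,\dots,3n-1\}$. For a set $S$ of integers, $\overline S=\{\overline{s(2n-1)}\mid s\in S\}$, where $\overline r$ is the remainder of $r$ on division by $4n$. Also $\gcd(4n,0)=4n$. Characters of $SD_{8n}$ ($i=\sqrt{-1}$): the linear characters are given by $\chi_0(a)=\chi_0(b)=1$; $\chi_1(a)=1,\chi_1(b)=-1$; $\chi_2(a)=-1,\chi_2(b)=1$; $\chi_3(a)=\chi_3(b)=-1$.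 For $h\in C^{\dag}_{even}$, $\varsigma_h$ is the degree 2 irreducible character with $\varsigma_h(a^k)=2\cos(\frac{hk\pi}{2n})$ and $\varsigma_h(ba^k)=0$ for all $k$. For $h'\in C^{\dag}_{odd}$, $\psi_{h'}$ is the degree 2 irreducible character with $\psi_{h'}(a^k)=2\cos(\frac{h'k\pi}{2n})$ for $k$ even, $\psi_{h'}(a^k)=2i\sin(\frac{h'k\pi}{2n})$ for $k$ odd, and $\psi_{h'}(ba^k)=0$ for all $k$.
   Formalization: In the last formula (for ψ_{h'}) the terms m^{4n} − m^{2n} are corrected to 2m^{4n} − 2m^{2n}; as printed it fails, e.g. for n=2, m=2, h'=1 it gives 30 while the dimension is 60. *)

(* Defs.v *)
From HB Require Import structures.
From mathcomp Require Import all_boot all_order all_fingroup all_algebra.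
From mathcomp Require Import mxrepresentation sesquilinear complex reals trigo zify.
Set Implicit Arguments.
Unset Strict Implicit.
Unset Printing Implicit Defensive.
Import Order.TTheory GRing.Theory Num.Theory.
Local Open Scope ring_scope.

Section TensorPower.
Variables (K : fieldType) (V : vectType K) (N : nat).

(* The N-th tensor power of V, in coordinates: w f is the coordinate of w on
   e_(f 0) (x) ... (x) e_(f (N-1)), where e is the basis [vbasis {:V}].
   That it is a tensor power, with pure tensors [tens v], is
   [tensor_power_universal] below. *)
Definition tensor_power : vectType K :=
  {ffun {ffun 'I_N -> 'I_(\dim {:V})} -> K^o}.

Definition tens (v : {ffun 'I_N -> V}) : tensor_power :=
  [ffun f : {ffun 'I_N -> 'I_(\dim {:V})} =>
     \prod_(i < N) coord (vbasis {:V}) (f i) (v i)].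

Definition upd (U : Type) (v : {ffun 'I_N -> U}) (i : 'I_N) (x : U)
  : {ffun 'I_N -> U} := [ffun j => if j == i then x else v j].

Definition multilinear (U : lmodType K) (F : {ffun 'I_N -> V} -> U) : Prop :=
  forall (v : {ffun 'I_N -> V}) (i : 'I_N) (c : K) (x y : V),
    F (upd v i (c *: x + y)) = c *: F (upd v i x) + F (upd v i y).

Definition perm_fun (s : 'S_N) (w : tensor_power) : tensor_power :=
  [ffun f : {ffun 'I_N -> 'I_(\dim {:V})} => w [ffun i => f (s i)]].

Lemma perm_fun_is_linear s : linear (perm_fun s).
Proof. by move=> c w w'; apply/ffunP => f; rewrite !ffunE. Qed.

HB.instance Definition _ s :=
  GRing.isLinear.Build K tensor_power tensor_power _ (perm_fun s)
    (perm_fun_is_linear s).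

(* See [perm_opE] for the action on pure tensors. *)
Definition perm_op (s : 'S_N) : 'End(tensor_power) := linfun (perm_fun s).

Lemma perm_opE s (v : {ffun 'I_N -> V}) :
  perm_op s (tens v) = tens [ffun i => v ((s^-1)%g i)].
Proof.
rewrite lfunE /=; apply/ffunP => f; rewrite !ffunE.
rewrite [RHS](reindex_inj (@perm_inj _ s)) /=.
by apply: eq_bigr => i _; rewrite !ffunE permK.
Qed.

Lemma tens_multilinear : multilinear tens.
Proof.
move=> v i c x y; apply/ffunP => f; rewrite !ffunE.
have E z : \prod_(j < N) coord (vbasis {:V}) (f j) (upd v i z j) =
    coord (vbasis {:V}) (f i) z *
    \prod_(j < N | j != i) coord (vbasis {:V}) (f j) (v j).
  rewrite (bigD1 i) //= ffunE eqxx; congr (_ * _).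
  by apply: eq_bigr => j /negbTE ji; rewrite ffunE ji.
by rewrite !E linearP mulrDl -mulrA.
Qed.

Section Universal.
Variables (U : lmodType K) (F : {ffun 'I_N -> V} -> U).
Hypothesis Fml : multilinear F.

Let e := vbasis {:V}.

Lemma multilinear_sum (I : finType) v i (c : I -> K) (x : I -> V) :
  F (upd v i (\sum_j c j *: x j)) = \sum_j c j *: F (upd v i (x j)).
Proof.
have F0 : F (upd v i 0) = 0.
  have := Fml v i 1 0 0; rewrite !scale1r addr0 => /eqP.
  by rewrite -subr_eq subrr => /eqP.
apply: (big_ind2 (fun y u => F (upd v i y) = u)) => // [y1 u1 y2 u2 <- <-|j _].
  by rewrite -[y1]scale1r Fml !scale1r.
by rewrite -[c j *: _]addr0 Fml F0 addr0.
Qed.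

Let d := \dim {:V}.

Let mix (s : seq 'I_N) (v : {ffun 'I_N -> V}) (f : {ffun 'I_N -> 'I_d}) :=
  [ffun i => if i \in s then e`_(f i) else v i].

Lemma multilinear_expand_seq (j0 : 'I_d) (v : {ffun 'I_N -> V}) s : uniq s ->
  \sum_(f : {ffun 'I_N -> 'I_d} | [forall i, (i \notin s) ==> (f i == j0)])
    (\prod_(i <- s) coord e (f i) (v i)) *: F (mix s v f) = F v.
Proof.
elim: s => [_|i s IHs /= /andP[is_ us]].
  rewrite (big_pred1 [ffun=> j0]) => [|f].
    by rewrite big_nil scale1r; congr F; apply/ffunP => i; rewrite !ffunE.
  apply/forallP/eqP => [H|-> i]; last by rewrite ffunE eqxx implybT.
  by apply/ffunP => i; rewrite ffunE; apply/eqP; exact: (implyP (H i)).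
rewrite -[RHS](IHs us) (partition_big (fun f : {ffun 'I_N -> 'I_d} => f i) predT) //=.
pose T (j : 'I_d) (g : {ffun 'I_N -> 'I_d}) :=
  (\prod_(k <- s) coord e (g k) (v k)) *:
    (coord e j (v i) *: F (upd (mix s v g) i e`_j)).
transitivity (\sum_(j < d) \sum_(g : {ffun 'I_N -> 'I_d}
    | [forall k, (k \notin s) ==> (g k == j0)]) T j g).
  apply: eq_bigr => j _.
  rewrite (reindex_onto (fun g : {ffun 'I_N -> 'I_d} => upd g i j)
                        (fun f => upd f i j0)) /=; last first.
    move=> f /andP[_ /eqP fij]; apply/ffunP => k; rewrite !ffunE.
    by case: eqP => // ->.
  apply: eq_big => [g|g _]; last first.
    rewrite /T big_cons scalerA [in RHS]mulrC.
    have -> : coord e (upd g i j i) (v i) = coord e j (v i) by rewrite ffunE eqxx.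
    congr (_ * _ *: F _).
      apply: eq_big_seq => k ks.
      by rewrite ffunE; case: eqP => // ki; rewrite ki (negbTE is_) in ks.
    apply/ffunP => k; rewrite !ffunE inE; case: eqP => // ki.
  rewrite [X in (_ && (X == j)) && _]ffunE !eqxx andbT.
  apply/andP/forallP => [[/forallP H /eqP E] k|H].
    apply/implyP => ks; case: (eqVneq k i) => [->|ki].
      by rewrite -E !ffunE eqxx.
    by have := H k; rewrite inE (negbTE ki) /= ks !ffunE (negbTE ki).
  split.
    apply/forallP => k; rewrite inE negb_or ffunE; apply/implyP => /andP[ki ks].
    by rewrite (negbTE ki); exact: (implyP (H k)).
  apply/eqP/ffunP => k; rewrite !ffunE; case: eqP => // ->.
  by apply/esym/eqP; exact: (implyP (H i)).
rewrite exchange_big /=; apply: eq_bigr => g _.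
rewrite -scaler_sumr; congr (_ *: _); rewrite -multilinear_sum.
rewrite -(coord_vbasis (memvf (v i))); congr F.
by apply/ffunP => k; rewrite !ffunE; case: eqP => // ->; rewrite (negbTE is_).
Qed.

Lemma multilinear_expand (v : {ffun 'I_N -> V}) :
  F v = \sum_f (tens v f : K) *: F [ffun i => e`_(f i)].
Proof.
have [j0 _|d0] := pickP (@predT 'I_d).
  rewrite -[LHS](multilinear_expand_seq j0 v (index_enum_uniq 'I_N)).
  apply: eq_big => [f|f _].
    by apply/forallP => k; rewrite mem_index_enum.
  rewrite ffunE; congr (_ *: F _).
  by apply/ffunP => k; rewrite !ffunE mem_index_enum.
have [i _|N0] := pickP (@predT 'I_N).
  rewrite [RHS]big1 => [|f]; last by have := d0 (f i).
  have -> : v = upd v i (\sum_(j < d) (0 : K) *: (0 : V)).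
    apply/ffunP => k; rewrite ffunE; case: eqP => // ->.
    rewrite (coord_vbasis (memvf (v i))) !big1 // => j; by have := d0 j.
  by rewrite multilinear_sum big1 // => j; have := d0 j.
have Nnil (T : Type) (f g : {ffun 'I_N -> T}) : f = g.
  by apply/ffunP => i; have := N0 i.
have j0 : {ffun 'I_N -> 'I_d}.
  by apply: finfun => i; have := N0 i.
rewrite (big_pred1 j0) => [|f]; last by rewrite /= (Nnil _ f j0) eqxx.
rewrite ffunE big_pred0 // scale1r; congr F; exact: Nnil.
Qed.

End Universal.

Lemma tens_basis (w : tensor_power) :
  w = \sum_f (w f : K) *: tens [ffun i => (vbasis {:V})`_(f i)].
Proof.
apply/ffunP => g; rewrite sum_ffunE (bigD1 g) //= [X in _ + X]big1 => [|f fg].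
  rewrite !ffunE big1 ?addr0 => [|i _]; first by rewrite [RHS]mulr1.
  by rewrite ffunE coord_free ?eqxx // (basis_free (vbasisP _)).
rewrite !ffunE; have [i fgi] : exists i, g i != f i.
  apply/existsP; rewrite -negb_forall; apply: contra fg => /forallP fg.
  by apply/eqP/ffunP => i; apply/esym/eqP.
rewrite (bigD1 i) //= ffunE coord_free ?(basis_free (vbasisP _)) //.
by rewrite eq_sym (negbTE fgi) mul0r; exact: mulr0.
Qed.

Theorem tensor_power_universal (U : lmodType K) (F : {ffun 'I_N -> V} -> U) :
  multilinear F ->
  exists2 g : {linear tensor_power -> U}, (forall v, g (tens v) = F v)
    & forall g' : {linear tensor_power -> U},
        (forall v, g' (tens v) = F v) -> g' =1 g.
Proof.
move=> Fml.
pose g (w : tensor_power) :=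
  \sum_f (w f : K) *: F [ffun i => (vbasis {:V})`_(f i)].
have g_lin : linear g.
  move=> c w w'; rewrite /g scaler_sumr -big_split /=; apply: eq_bigr => f _.
  by rewrite !ffunE scalerDl scalerA.
pose gL := HB.pack_for {linear tensor_power -> U} g
  (GRing.isLinear.Build K tensor_power U _ g g_lin).
exists gL => [v|g' Hg' w]; first by rewrite /= /g -multilinear_expand.
rewrite [in LHS](tens_basis w) linear_sum; apply: eq_bigr => f _.
by rewrite linearZ Hg'.
Qed.

(* T(G, chi), for any scalar function chi; only its values on G matter. *)
Definition sym_op (G : {group 'S_N}) (chi : 'S_N -> K) : 'End(tensor_power) :=
  (chi 1%g / #|G|%:R) *: \sum_(s in G) chi s *: perm_op s.

Definition sym_class (G : {group 'S_N}) (chi : 'S_N -> K)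
  : {vspace tensor_power} := limg (sym_op G chi).

End TensorPower.

(* The library's 'CF(G) takes its values in algC; here the scalars are those of
   the representation. *)
Definition irr_character (K : fieldType) (gT : finGroupType) (G : {group gT})
    (chi : gT -> K) : Prop :=
  exists (d : nat) (rG : mx_representation K G d),
    mx_irreducible rG /\ forall g, g \in G -> chi g = \tr (rG g).

Definition linear_character (K : fieldType) (gT : finGroupType) (G : {group gT})
    (chi : gT -> K) : Prop :=
  irr_character G chi /\ chi 1%g = 1.

Section SemiDihedral.
Variable n : nat.

(* The points {1, ..., 4n} are the residues 'I_(4n), and [ordS] is t |-> t + 1
   modulo 4n. *)
Definition sd_mul (t : 'I_(4 * n)) : 'I_(4 * n) :=
  Ordinal (ltn_pmod ((2 * n - 1) * t) (leq_ltn_trans (leq0n t) (ltn_ord t))).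

Lemma sd_mulK : involutive sd_mul.
Proof.
move=> t; apply: val_inj => /=.
have n0 : (0 < n)%N by have := leq_ltn_trans (leq0n t) (ltn_ord t); lia.
rewrite modnMmr mulnA -[RHS](modn_small (ltn_ord t)).
have -> : ((2 * n - 1) * (2 * n - 1) = (n - 1) * (4 * n) + 1)%N.
  by nia.
by rewrite mulnDl mul1n mulnAC modnMDl.
Qed.

Definition sd_a : 'S_(4 * n) := perm (@ordS_inj (4 * n)).
Definition sd_b : 'S_(4 * n) := perm (inv_inj sd_mulK).
Definition SD : {group 'S_(4 * n)} := <<[set sd_a; sd_b]>>%G.

Lemma sd_aX k (t : 'I_(4 * n)) : (sd_a ^+ k)%g t = ((t + k) %% (4 * n))%N :> nat.
Proof.
elim: k => [|k IHk]; first by rewrite expg0 perm1 addn0 modn_small.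
by rewrite expgSr permM permE /= IHk -addn1 modnDml -addnA addn1.
Qed.

Lemma sd_presentation : [/\ sd_a ^+ (4 * n) = 1, sd_b ^+ 2 = 1
  & sd_b * sd_a * sd_b = sd_a ^+ (2 * n - 1)]%g.
Proof.
split; apply/permP => t.
- by apply: val_inj; rewrite /= sd_aX perm1 modnDr modn_small.
- by rewrite expgS expg1 permM !permE sd_mulK.
apply: val_inj; rewrite /= sd_aX !permM !permE /=.
have /(congr1 val) /= E := sd_mulK t.
by rewrite modnMmr mulnS addnC -modnDml E.
Qed.

(* MathComp composes permutations from left to right, so [sd_b * sd_a ^+ k] is
   b a^((2n-1)k) for composition from right to left; the characters below agree
   on the two. *)

Definition C_even : {set 'I_(4 * n)} :=
  [set k : 'I_(4 * n) | ~~ odd k & (2 <= k <= 2 * n - 2)%N].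
Definition C_odd : {set 'I_(4 * n)} :=
  [set k : 'I_(4 * n) | odd k &
     (1 <= k <= n - 1)%N || (2 * n + 1 <= k <= 3 * n - 1)%N].
Definition obar (S : {set 'I_(4 * n)}) : {set 'I_(4 * n)} := sd_mul @: S.

Variable R : realType.

Definition sd_linear (u v : R[i]) (chi : 'S_(4 * n) -> R[i]) : Prop :=
  [/\ linear_character SD chi, chi sd_a = u & chi sd_b = v].

Definition sd_varsigma (h : nat) (chi : 'S_(4 * n) -> R[i]) : Prop :=
  irr_character SD chi /\
  forall k : 'I_(4 * n),
    chi (sd_a ^+ k)%g = (2 * cos ((h * k)%:R * pi / (2 * n)%:R))%:C%C /\
    chi (sd_b * sd_a ^+ k)%g = 0.

Definition sd_psi (h : nat) (chi : 'S_(4 * n) -> R[i]) : Prop :=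
  irr_character SD chi /\
  forall k : 'I_(4 * n),
    chi (sd_a ^+ k)%g =
      (if odd k then 2 * 'i * (sin ((h * k)%:R * pi / (2 * n)%:R))%:C
       else (2 * cos ((h * k)%:R * pi / (2 * n)%:R))%:C)%C /\
    chi (sd_b * sd_a ^+ k)%g = 0.

End SemiDihedral.

(* Main.v *)
(* The symmetrizer is idempotent by the orthogonality of matrix coefficients
   (Schur), so its rank is its trace. A permutation with c cycles has trace m^c
   on the tensor power, hence the dimension is chi(1)/|G| times the sum of
   chi(s) m^(c(s)). The group <a> acts freely, so a^k has gcd(4n,k) cycles. The
   square of b a^k is a^(2nk): for k even b a^k is an involution with two fixed
   points, giving 2n+1 cycles, and for k odd all its cycles have length 4. *)

Require Import Defs.
From mathcomp Require Import all_boot all_order all_fingroup all_algebra.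
From mathcomp Require Import mxrepresentation sesquilinear complex reals trigo.
From mathcomp Require Import cyclic ring zify.
Import Order.TTheory GRing.Theory Num.Theory.
Import VectorInternalTheory.
Local Open Scope ring_scope.
Set Implicit Arguments.
Unset Strict Implicit.

(** * Rank and trace of idempotent endomorphisms *)

(** Rank factorization: A = CR with C of full column rank and R of full row rank. Then tr A =
    tr(RC), and cancelling C and R in CRCR = CR leaves RC = 1, of size the rank. *)
Lemma mxtrace_idempotent (K : fieldType) (d : nat) (A : 'M[K]_d) :
  A *m A = A -> \tr A = (\rank A)%:R.
Proof.
move=> AA; rewrite -{1}(mulmx_base A) mxtrace_mulC.
suff -> : row_base A *m col_base A = 1%:M by rewrite mxtrace1.
apply: (row_free_inj (row_base_free A)); rewrite mul1mx.
apply: (row_full_inj (col_base_full A)).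
by rewrite -(mulmxA (row_base A)) mulmx_base mulmxA mulmx_base AA.
Qed.

Lemma mul_v2r_f2mx (K : fieldType) (U W : vectType K) (f : 'Hom(U, W)) (w : U) :
  v2r w *m f2mx f = v2r (f w).
Proof. by rewrite [in RHS]unlock /= r2vK. Qed.

Lemma dim_limg_idempotent (K : fieldType) (U : vectType K) (f : 'End(U)) :
  (forall w, f (f w) = f w) -> (\dim (limg f))%:R = \tr (f2mx f).
Proof.
move=> ff; rewrite mxtrace_idempotent.
  by rewrite unlock /dimv genmxE (eqmxMr _ (genmxE _)) mul1mx.
apply/row_matrixP => i; rewrite !rowE mulmxA -(r2vK (delta_mx 0 i)).
by rewrite !mul_v2r_f2mx ff.
Qed.

(** The matrix [f2mx f] is taken in the coordinates [v2r], about which nothing is known; this is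
    invariance of the trace under passage to the basis of indicator functions. *)
Lemma mxtrace_ffun (K : fieldType) (I : finType) (f : 'End({ffun I -> K^o})) :
  \tr (f2mx f) = \sum_i f [ffun j => (j == i)%:R] i.
Proof.
pose e i : {ffun I -> K^o} := [ffun j => (j == i)%:R].
have expand (w : {ffun I -> K^o}) : w = \sum_i w i *: e i.
  apply/ffunP => i; rewrite sum_ffunE (bigD1 i) //= !ffunE eqxx big1 ?addr0 => [|j ji].
    by rewrite [RHS]mulr1.
  by rewrite !ffunE eq_sym (negbTE ji); exact: mulr0.
(* The two change-of-basis matrices are inverse to each other. *)
have coefE j i : \sum_k (r2v (delta_mx 0 j) : {ffun I -> K^o}) k * v2r (e k) 0 i
   = (j == i)%:R.
  have := congr1 (fun w => v2r w 0 i) (expand (r2v (delta_mx 0 j))).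
  rewrite /= r2vK linear_sum summxE mxE eqxx eq_sym /= => ->.
  by apply: eq_bigr => k _; rewrite linearZ mxE.
transitivity (\sum_i \sum_j
  v2r (f (e i)) 0 j * (r2v (delta_mx 0 j) : {ffun I -> K^o}) i).
  rewrite exchange_big; apply: eq_bigr => j _ /=.
  transitivity (\sum_k \sum_l
    (r2v (delta_mx 0 j) : {ffun I -> K^o}) k * v2r (e k) 0 l * f2mx f l j).
    rewrite exchange_big (bigD1 j) //= -mulr_suml coefE eqxx mul1r.
    rewrite big1 ?addr0 // => l lj.
    by rewrite -mulr_suml coefE eq_sym (negbTE lj) mul0r.
  apply: eq_bigr => k _; rewrite -mul_v2r_f2mx mxE mulr_suml; apply: eq_bigr => l _.
  by rewrite -mulrA mulrC.
apply: eq_bigr => i _; rewrite -[f _ in RHS]v2rK {2}[v2r _]row_sum_delta.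
rewrite linear_sum sum_ffunE.
by apply: eq_bigr => j _; rewrite linearZ ffunE.
Qed.

(** * Schur orthogonality and convolution of irreducible characters *)

Section Schur.
Variables (gT : finGroupType) (G : {group gT}).

(** The average [E] of the matrix unit at (i, j) commutes with the representation, so by Schur's
    lemma it is a scalar c. Its trace determines c, and its (k, l) entry is the required sum. *)
Lemma irr_matrix_orthogonality (K : fieldType) (d : nat)
    (rG : mx_representation K G d) (i j k l : 'I_d) :
  mx_absolutely_irreducible rG -> d%:R != 0 :> K ->
  \sum_(s in G) rG s k i * rG (s^-1)%g j l
    = #|G|%:R / d%:R * ((i == j) && (k == l))%:R.
Proof.
move=> absG d0; pose E := \sum_(s in G) rG s *m delta_mx i j *m rG (s^-1)%g.
have /is_scalar_mxP[c Ec] : is_scalar_mx E.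
  apply: (mx_abs_irr_cent_scalar absG); apply/centgmxP => t Gt.
  rewrite mulmx_suml mulmx_sumr [LHS](reindex_inj (mulgI t)) /=.
  apply: eq_big => [s|s Gs]; first by rewrite groupMl.
  have {}Gs : s \in G by rewrite -(groupMl _ Gt).
  by rewrite invMg repr_mxM // repr_mxM ?groupV // !mulmxA repr_mxKV ?groupV.
have trE : \tr E = #|G|%:R * (i == j)%:R.
  rewrite raddf_sum /= -sum1_card natr_sum mulr_suml; apply: eq_bigr => s Gs.
  rewrite mxtrace_mulC mulmxA -repr_mxM ?groupV // mulVg repr_mx1 mul1mx mul1r.
  rewrite /mxtrace (bigD1 i) //= big1 ?addr0 => [|a ai]; rewrite mxE ?eqxx //.
  by rewrite (negbTE ai).
have cE : c = #|G|%:R / d%:R * (i == j)%:R.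
  move: trE; rewrite Ec mxtrace_scalar -[c *+ d]mulr_natr => trE.
  by apply: (mulIf d0); rewrite trE mulrAC divfK.
transitivity (E k l).
  rewrite summxE; apply: eq_bigr => s _; rewrite mxE (bigD1 j) //= big1 ?addr0.
    by rewrite mxE (bigD1 i) //= big1 ?addr0 ?mxE ?eqxx ?mulr1 // => a ai;
       rewrite mxE (negbTE ai) mulr0.
  move=> b bj; rewrite mxE big1 ?mul0r // => a _.
  by rewrite mxE (negbTE bj) andbF mulr0.
by rewrite Ec mxE -[c *+ _]mulr_natr cE -mulnb natrM mulrA.
Qed.

(** Both traces are expanded in matrix coefficients, the second through the product of the matrices
    of s^-1 and t. Orthogonality kills all terms but i = j = l, which add up to the trace at t. *)
Lemma irr_character_convolution (K : closedFieldType) (chi : gT -> K) (t : gT) :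
  [pchar K] =i pred0 -> irr_character G chi -> t \in G ->
  \sum_(s in G) chi s * chi (s^-1 * t)%g = #|G|%:R / chi 1%g * chi t.
Proof.
move=> /pcharf0P K0 [d [rG [irrG chiE]]] Gt.
have absG := group_closure_closed_field irrG.
have d0 : d%:R != 0 :> K by rewrite K0 -lt0n; case/andP: absG.
have orth i j k l := irr_matrix_orthogonality i j k l absG d0.
rewrite [chi 1%g]chiE // repr_mx1 mxtrace1 [chi t]chiE //.
transitivity (\sum_(s in G) \sum_i \sum_j \sum_l
    rG s i i * rG (s^-1)%g j l * rG t l j).
  apply: eq_bigr => s Gs; rewrite !chiE ?groupM ?groupV // repr_mxM ?groupV //.
  rewrite mulr_suml; apply: eq_bigr => i _; rewrite mulr_sumr.
  apply: eq_bigr => j _; rewrite mxE mulr_sumr; apply: eq_bigr => l _.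
  by rewrite mulrA.
rewrite exchange_big mulr_sumr; apply: eq_bigr => i _ /=.
rewrite exchange_big (bigD1 i) //= exchange_big (bigD1 i) //=.
rewrite -mulr_suml orth !eqxx mulr1 !big1 ?addr0 //.
  move=> j ji; rewrite exchange_big big1 //= => l _.
  by rewrite -mulr_suml orth eq_sym (negbTE ji) mulr0 mul0r.
by move=> l li; rewrite -mulr_suml orth eq_sym (negbTE li) andbF mulr0 mul0r.
Qed.
End Schur.

(** * The symmetrizer and the dimension of its image *)

Section SymClass.
Variables (K : closedFieldType) (V : vectType K) (N : nat).
Hypothesis K0 : [pchar K] =i pred0.

Lemma perm_opM (s t : 'S_N) (w : tensor_power V N) :
  perm_op V s (perm_op V t w) = perm_op V (t * s)%g w.
Proof.
rewrite !lfunE; apply/ffunP => f /=; rewrite !ffunE; congr (w _).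
by apply/ffunP => i; rewrite !ffunE permM.
Qed.

Lemma sym_opE (G : {group 'S_N}) chi (w : tensor_power V N) :
  sym_op V G chi w
    = (chi 1%g / #|G|%:R) *: \sum_(s in G) chi s *: perm_op V s w.
Proof.
rewrite scale_lfunE sum_lfunE; congr (_ *: _).
by apply: eq_bigr => s _; rewrite scale_lfunE.
Qed.

(** In the square of the symmetrizer the coefficient of [perm_op V g] is, up to the normalizing
    factors, the convolution of [chi] with itself at g, hence a multiple of chi(g). The
    normalization chi(1)/|G| absorbs that multiple. *)
Lemma sym_op_idempotent (G : {group 'S_N}) chi (w : tensor_power V N) :
  irr_character G chi -> sym_op V G chi (sym_op V G chi w) = sym_op V G chi w.
Proof.
move=> irr; rewrite [in LHS]sym_opE.
have chi1 : chi 1%g != 0.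
  case: irr => d [rG [irrG ->]] //; rewrite repr_mx1 mxtrace1.
  have /andP[d0 _] := group_closure_closed_field irrG.
  by move/pcharf0P: K0 => ->; rewrite -lt0n.
have G0 : #|G|%:R != 0 :> K by move/pcharf0P: K0 => ->; rewrite -lt0n cardG_gt0.
have -> : \sum_(s in G) chi s *: perm_op V s (sym_op V G chi w)
    = (chi 1%g / #|G|%:R) *:
      \sum_(s in G) \sum_(t in G) (chi t * chi s) *: perm_op V (t * s)%g w.
  rewrite scaler_sumr; apply: eq_bigr => s Gs.
  rewrite sym_opE [perm_op _ _ _]linearZ /= linear_sum /= !scaler_sumr.
  apply: eq_bigr => t Gt.
  by rewrite [perm_op V s _]linearZ /= perm_opM !scalerA; congr (_ *: _); ring.
rewrite exchange_big /= sym_opE; congr (_ *: _).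
(* Substitution g = ts, which collects the terms with the same operator. *)
rewrite (eq_bigr (fun t => \sum_(g in G)
    (chi t * chi (t^-1 * g)%g) *: perm_op V g w)); last first.
  move=> t Gt; rewrite (reindex_inj (mulgI t^-1%g)) /=.
  apply: eq_big => [g|g _]; first by rewrite groupMl ?groupV.
  by rewrite mulKVg.
rewrite exchange_big scaler_sumr; apply: eq_bigr => t Gt.
rewrite -scaler_suml irr_character_convolution // scalerA mulrA; congr (_ *: _).
by field; rewrite chi1.
Qed.
End SymClass.

(** An invariant function is constant on cycles, so it factors through the set of cycles; [F] is the
    resulting bijection. *)
Lemma card_perm_invariant_ffun (I T : finType) (s : {perm I}) :
  #|[set f : {ffun I -> T} | [forall i, f (s i) == f i]]|
    = (#|T| ^ #|porbits s|)%N.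
Proof.
have porbit_in i : porbit s i \in porbits s by exact: imset_f.
(* [q] sends a point to the index of its cycle, and [r] below picks a representative of each
   cycle. *)
pose q i := enum_rank_in (porbit_in i) (porbit s i).
have qE i : enum_val (q i) = porbit s i by rewrite enum_rankK_in.
have r (k : 'I_#|porbits s|) : {x | enum_val k = porbit s x}.
  have [x /eqP ->|E] := pickP (fun x => enum_val k == porbit s x); first by exists x.
  by exfalso; have /imsetP[x _ kx] := enum_valP k; move: (E x); rewrite kx eqxx.
have qr k : q (sval (r k)) = k by apply: enum_val_inj; rewrite qE -(svalP (r k)).
pose F (g : {ffun 'I_#|porbits s| -> T}) := [ffun i => g (q i)].
have F_inj : injective F.
  by move=> g g' /ffunP E; apply/ffunP => k; have:= E (sval (r k)); rewrite !ffunE qr.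
rewrite -[in RHS](card_ord #|porbits s|) -card_ffun -cardsT -(card_imset _ F_inj).
congr #|pred_of_set _|; apply/setP => f; rewrite inE.
apply/forallP/imsetP => [f_inv|[g _ ->] i]; last first.
  rewrite !ffunE; apply/eqP; congr (g _); apply: enum_val_inj; rewrite !qE.
  exact: (porbit_perm s 1 i).
exists [ffun k => f (sval (r k))] => //; apply/ffunP => i; rewrite !ffunE.
have : porbit s i = porbit s (sval (r (q i))) by rewrite -(svalP (r (q i))) qE.
move/eqP; rewrite eq_porbit_mem porbit_sym => /porbitP[k ->].
by elim: k => [|k IHk]; rewrite ?expg0 ?perm1 // expgSr permM (eqP (f_inv _)).
Qed.

(** The operator of s permutes the basis tensors, so its trace counts the index functions f
    invariant under s. *)
Lemma dim_sym_class (K : closedFieldType) (V : vectType K) (N : nat)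
    (G : {group 'S_N}) (chi : 'S_N -> K) :
  [pchar K] =i pred0 -> irr_character G chi ->
  (\dim (sym_class V G chi))%:R = chi 1%g / #|G|%:R *
    \sum_(s in G) chi s * (\dim {:V})%:R ^+ #|porbits s|.
Proof.
move=> K0 irr; rewrite dim_limg_idempotent => [|w]; last exact: sym_op_idempotent.
rewrite mxtrace_ffun.
rewrite (eq_bigr _ (fun f _ =>
  congr1 (fun w : tensor_power V N => w f) (sym_opE _ _ _))).
under eq_bigr => f _ do rewrite ffunE sum_ffunE.
rewrite -scaler_sumr exchange_big /=; congr (_ * _); apply: eq_bigr => s _.
under eq_bigr => f _ do rewrite ffunE lfunE /= !ffunE.
rewrite -scaler_sumr; congr (_ * _).
rewrite -natrX.
have := card_perm_invariant_ffun 'I_(\dim {:V}) s; rewrite card_ord => <-.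
rewrite -sum1_card natr_sum.
rewrite [RHS]big_mkcond; apply: eq_bigr => f _; rewrite inE.
have -> : ([ffun i => f (s i)] == f) = [forall i, f (s i) == f i].
  apply/eqP/forallP => [/ffunP E i|E]; first by rewrite -(E i) ffunE.
  by apply/ffunP => i; rewrite ffunE; apply/eqP.
by case: ifP.
Qed.

(** In characteristic 0 the value 1 at the identity forces degree 1, and the trace of a 1 by 1
    matrix is multiplicative. *)
Lemma linear_characterM (K : fieldType) (gT : finGroupType) (G : {group gT})
    (chi : gT -> K) :
  [pchar K] =i pred0 -> linear_character G chi ->
  {in G &, {morph chi : x y / (x * y)%g >-> x * y}}.
Proof.
move=> /pcharf0P K0 [[d [rG [_ chiE]]] chi1] x y Gx Gy.
have d1 : d = 1%N.
  move: chi1; rewrite chiE // repr_mx1 mxtrace1 => /eqP; rewrite -subr_eq0.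
  case: d rG chiE => [|d] rG chiE; first by rewrite sub0r oppr_eq0 oner_eq0.
  by rewrite mulrSr addrK K0 => /eqP ->.
move: rG chiE; rewrite d1 => rG chiE.
by rewrite !chiE ?groupM // repr_mxM // !trace_mx11 mxE big_ord1.
Qed.

(** * Counting the cycles of a permutation *)

Lemma big_cycle (R : Type) (idx : R) (op : Monoid.com_law idx)
    (gT : finGroupType) (x : gT) (F : gT -> R) :
  \big[op/idx]_(g in <[x]>%g) F g = \big[op/idx]_(i < #[x]%g) F (x ^+ i)%g.
Proof.
have x_inj : {in predT &, injective (fun i : 'I_#[x]%g => x ^+ i)%g}.
  move=> i j _ _ /eqP; rewrite eq_expg_mod_order !modn_small // => /eqP.
  exact: val_inj.
rewrite -(big_imset F x_inj); apply: eq_bigl => g.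
apply/cycleP/imsetP => [[i ->]|[i _ ->]]; last by exists i.
by exists (Ordinal (ltn_pmod i (order_gt0 x))); rewrite //= expg_mod_order.
Qed.

(** Cauchy-Frobenius orbit counting for the natural action of the cyclic group generated by s. *)
Lemma card_porbits (I : finType) (s : {perm I}) :
  (\sum_(i < #[s]%g) #|[set x | (s ^+ i)%g x == x]| = #|porbits s| * #[s]%g)%N.
Proof.
have := @Frobenius_Cauchy _ _ _ ('P)%act <[s]>%G [set: I].
rewrite (big_cycle _ s (fun g => #|('Fix_([set: I] | 'P)[g])%g|)) => E.
transitivity (\sum_(i < #[s]%g) #|('Fix_([set: I] | 'P)[s ^+ i])%g|)%N.
  apply: eq_bigr => i _; congr #|pred_of_set _|; apply/setP => x.
  by rewrite !inE sub1set inE.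
rewrite E => [|]; last first.
  by apply/subsetP => g _; rewrite !inE; apply/subsetP => x; rewrite !inE.
congr (_ * _)%N; congr #|pred_of_set _|; rewrite /porbits porbitE.
by apply/setP => A; apply/imsetP/imsetP => -[x _ ->]; exists x; rewrite ?inE.
Qed.

(** Only the identity has fixed points, so the orbit count reduces to its term at i = 0. *)
Lemma card_porbits_semiregular (I : finType) (s : {perm I}) :
  (forall i x, (0 < i < #[s]%g)%N -> (s ^+ i)%g x != x) ->
  #|I| = (#|porbits s| * #[s]%g)%N.
Proof.
move=> s_free; rewrite -card_porbits (bigD1 (Ordinal (order_gt0 s))) //=.
rewrite big1 ?addn0 => [|i i0].
  by rewrite -cardsT; congr #|pred_of_set _|; apply/setP => x; rewrite !inE perm1 eqxx.
apply/eqP; rewrite cards_eq0 -subset0; apply/subsetP => x; rewrite !inE.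
by rewrite (negbTE (s_free _ _ _)) // ltn_ord andbT lt0n.
Qed.

(** Turns a fixed-point congruence modulo 2n into two explicit points modulo 4n. *)
Lemma modn_eq_double (N r t : nat) : (r < N)%N -> (t < 2 * N)%N ->
  (t %% N == r)%N = (t == r) || (t == r + N)%N.
Proof.
move=> r_lt t_lt; have [tN|tN] := ltnP t N; first by rewrite modn_small //; lia.
by rewrite -{1}(subnK tN) modnDr modn_small; lia.
Qed.

(** * The semi-dihedral group and the cycle numbers of its elements *)

Section SemiDihedralGroup.
Variable n : nat.
Hypothesis n_ge2 : (2 <= n)%N.

Local Notation a := (sd_a n).
Local Notation b := (sd_b n).

Let n4_gt0 : (0 < 4 * n)%N. Proof. by lia. Qed.
Let zero : 'I_(4 * n) := Ordinal n4_gt0.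

Lemma order_sd_a : #[a]%g = (4 * n)%N.
Proof.
have [aN _ _] := sd_presentation n.
apply/eqP; rewrite eqn_dvd order_dvdn aN eqxx /=.
by have /eqP := sd_aX #[a]%g zero; rewrite expg_order perm1 /= add0n eq_sym.
Qed.

Lemma sd_a_fix (k : nat) (t : 'I_(4 * n)) :
  ((a ^+ k)%g t == t) = (4 * n %| k)%N.
Proof.
rewrite -val_eqE /= sd_aX -{2}(modn_small (ltn_ord t)) -{2}[t : nat]addn0.
by rewrite eqn_modDl mod0n.
Qed.

(** Powers of a translation are semiregular, so every cycle has length the order 4n / gcd(4n, k). *)
Lemma card_porbits_sd_aX (k : nat) : #|porbits (a ^+ k)%g| = gcdn (4 * n) k.
Proof.
have /card_porbits_semiregular : forall i x,
    (0 < i < #[a ^+ k]%g)%N -> ((a ^+ k) ^+ i)%g x != x.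
  move=> i x /andP[i0 ik]; rewrite -expgM sd_a_fix -order_sd_a order_dvdn expgM.
  by rewrite -order_dvdn gtnNdvd.
rewrite card_ord orderXgcd order_sd_a => E.
have d0 : (0 < 4 * n %/ gcdn (4 * n) k)%N.
  by rewrite divn_gt0 ?gcdn_gt0 ?n4_gt0 // dvdn_leq ?dvdn_gcdl.
apply/eqP; rewrite -(eqn_pmul2r d0) -E.
by rewrite [X in _ == X]mulnC divnK ?dvdn_gcdl.
Qed.

Lemma order_sd_b : #[b]%g = 2.
Proof.
have [_ b2 _] := sd_presentation n.
apply: nt_prime_order => //; apply/eqP => /permP.
have n1 : (1 < 4 * n)%N by lia.
(* The point 1 goes to 2n - 1, which differs from 1 because n is at least 2. *)
move=> /(_ (Ordinal n1)) /(congr1 val); rewrite permE perm1 /= muln1 modn_small; lia.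
Qed.

(** [b] fixes the point 0, whereas a power of [a] with a fixed point is the identity. *)
Lemma sd_b_notin : b \notin <[a]>%g.
Proof.
apply/cycleP => -[k bk].
have : b zero == zero by rewrite permE -val_eqE /= muln0 mod0n.
rewrite bk sd_a_fix -order_sd_a order_dvdn -bk => /eqP b1.
by have := order_sd_b; rewrite b1 order1.
Qed.

Lemma sd_aX_b (k : nat) : (b * a ^+ k * b = a ^+ ((2 * n - 1) * k))%g.
Proof.
have [_ b2 bab] := sd_presentation n.
have bV : (b^-1 = b)%g by apply/eqP; rewrite eq_invg_mul -b2.
have := conjXg a b k; rewrite /conjg bV mulgA => ->.
by rewrite mulgA bab expgM.
Qed.

Lemma sd_baX_sqr (k : nat) : ((b * a ^+ k) ^+ 2 = a ^+ (2 * n * k))%g.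
Proof.
by rewrite expgS expg1 mulgA sd_aX_b -expgD; congr (_ ^+ _)%g; lia.
Qed.

(** Conjugation by [b] sends [a] to a^(2n-1), which again generates the rotations. Hence [b]
    normalizes them, and the generated group is the product of {1, b} with them. *)
Lemma SD_cosets : SD n = (<[a]> :|: b *: <[a]>)%g :> {set _}.
Proof.
have [_ b2 bab] := sd_presentation n.
have bV : (b^-1 = b)%g by apply/eqP; rewrite eq_invg_mul -b2.
have nab : (<[b]> \subset 'N(<[a]>))%g.
  rewrite cycle_subG; apply/normP; rewrite -cycleJ /conjg bV mulgA bab.
  apply/eqP; rewrite eqEcard cycleX /= -!orderE orderXgcd order_sd_a.
  have -> : gcdn (4 * n) (2 * n - 1) = 1%N.
    (* 2n - 1 is its own inverse modulo 4n, hence prime to 4n. *)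
    have /eqP : coprime (4 * n) ((2 * n - 1) * (2 * n - 1)).
      have -> : ((2 * n - 1) * (2 * n - 1) = (n - 1) * (4 * n) + 1)%N by nia.
      by rewrite /coprime gcdnMDl gcdn1.
    by move=> /eqP; rewrite -/(coprime _ _) coprimeMr andbb => /eqP.
  by rewrite divn1.
rewrite -[SD n : {set _}]/([set a] <*> [set b])%g -joing_idl -joing_idr joingC.
have -> : (<<[set b]>> <*> <<[set a]>> = [set 1; b] * <[a]>)%g.
  by rewrite -(cycle2g order_sd_b) -norm_joinEl.
apply/setP => g; apply/mulsgP/setUP => [[x y]|].
  case/set2P => -> ay ->; [left|right].
    by rewrite mul1g.
  by rewrite mem_lcoset mulKg.
case=> [ag|/lcosetP[y ay ->]]; first by exists 1%g g; rewrite ?mul1g // !inE eqxx.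
by exists b y; rewrite // !inE eqxx orbT.
Qed.

Lemma big_SD (R : Type) (idx : R) (op : Monoid.com_law idx) (F : _ -> R) :
  \big[op/idx]_(g in SD n) F g = op (\big[op/idx]_(k < 4 * n) F (a ^+ k)%g)
    (\big[op/idx]_(k < 4 * n) F (b * a ^+ k)%g).
Proof.
rewrite SD_cosets (eq_bigl [predU <[a]>%g & (b *: <[a]>)%g]) => [|g]; last first.
  by rewrite !inE.
rewrite bigU /=; last first.
  apply/pred0P => g /=; apply/andP => -[ag /lcosetP[y ay g_by]].
  by have /negP := sd_b_notin; apply; rewrite -(groupMr _ ay) -g_by.
rewrite big_cycle [X in op _ X](reindex_inj (mulgI b)) /=.
rewrite (eq_bigl (fun g => g \in <[a]>%g)) => [|g]; last by rewrite mem_lcoset mulKg.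
by rewrite big_cycle order_sd_a.
Qed.

Lemma card_SD : #|SD n| = (8 * n)%N.
Proof.
by rewrite -sum1_card big_SD /= !sum_nat_const !card_ord; lia.
Qed.

Hypothesis n_even : ~~ odd n.

(** For odd k the square of s is a^(2nk), of order 2 and without fixed points. So s has order 4 and
    is semiregular, and its 4-cycles partition the 4n points. *)
Lemma card_porbits_sd_baX_odd (k : nat) : odd k -> #|porbits (b * a ^+ k)%g| = n.
Proof.
move=> k_odd; set s := (b * a ^+ k)%g.
have k2 : (4 * n %| 2 * n * k)%N = false.
  by rewrite (_ : 4 * n = 2 * n * 2)%N ?dvdn_pmul2l ?dvdn2 ?k_odd //; lia.
have s4 : #[s]%g = 4.
  apply: (@orderXprime _ 2 2) => //; rewrite sd_baX_sqr.
  apply: nt_prime_order => //.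
    rewrite -expgM; apply/eqP; rewrite -order_dvdn order_sd_a.
    by apply/dvdnP; exists k; lia.
  by rewrite -order_dvdn order_sd_a k2.
have /card_porbits_semiregular : forall i x, (0 < i < #[s]%g)%N -> (s ^+ i)%g x != x.
  (* A point fixed by s^i is fixed by s^(2i) = a^(2nki), which forces i even, so i = 2; but the
     square of s moves every point. *)
  move=> i x i4; apply/negP => /eqP six.
  have : ((s ^+ i) ^+ 2)%g x == x by rewrite expgS expg1 permM !six.
  rewrite -expgM (mulnC i) expgM sd_baX_sqr -expgM sd_a_fix => dv_i.
  have i_even : ~~ odd i.
    move: dv_i; rewrite (_ : 4 * n = 2 * n * 2)%N; last by lia.
    by rewrite -(mulnA (2 * n)%N) dvdn_pmul2l ?dvdn2 ?oddM ?k_odd //; lia.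
  have i2 : i = 2 by rewrite s4 in i4; lia.
  by move: six => /eqP; rewrite i2 sd_baX_sqr sd_a_fix k2.
by rewrite card_ord s4; lia.
Qed.

(** With k = 2j, the fixed-point condition is 2n | (n-1)t + j. For n even, n^2 is 0 modulo 2n, so
    (n-1)(n+1) is -1 and the unique solution modulo 2n is (n+1)j. *)
Lemma sd_ba_fix (k : nat) (t : 'I_(4 * n)) : ~~ odd k ->
  ((b * a ^+ k)%g t == t) = (t == (n + 1) * k./2 %[mod 2 * n])%N.
Proof.
move=> k_even; rewrite permM -val_eqE /= sd_aX permE /= modnDml.
rewrite -{2}(modn_small (ltn_ord t)).
set j := k./2; have -> : k = (2 * j)%N by lia.
set c := n./2; have n_c : (n * n = c * (2 * n))%N by nia.
have -> : ((2 * n - 1) * t + 2 * j = t + 2 * ((n - 1) * t + j))%N by nia.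
rewrite -[X in _ == X %[mod _]]addn0 eqn_modDl mod0n -/(dvdn _ _).
rewrite [X in (X %| _)%N](_ : _ = 2 * (2 * n))%N ?dvdn_pmul2l //; last by lia.
apply/idP/eqP => [/dvdnP[q E]|E].
  (* The divisibility relation multiplied by n + 1, with n^2 replaced by 2nc. *)
  have E2 : (q * (n + 1) * (2 * n) + t = c * t * (2 * n) + (n + 1) * j)%N by nia.
  by move: (congr1 (modn^~ (2 * n)) E2); rewrite /= !modnMDl.
rewrite /dvdn -modnDml -modnMmr E modnMmr modnDml.
by rewrite (_ : _ + _ = c * j * (2 * n))%N ?modnMl //; nia.
Qed.

Lemma card_porbits_sd_baX_even (k : nat) : ~~ odd k ->
  #|porbits (b * a ^+ k)%g| = (2 * n + 1)%N.
Proof.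
move=> k_even; set s := (b * a ^+ k)%g.
have s2 : #[s]%g = 2.
  apply: nt_prime_order => //.
    rewrite sd_baX_sqr; apply/eqP; rewrite -order_dvdn order_sd_a.
    by apply/dvdnP; exists k./2; rewrite -{1}(even_halfK k_even); lia.
  apply/eqP => s1; have /negP := sd_b_notin; apply.
  by rewrite -(groupMr _ (mem_cycle a k)) -/s s1 group1.
(* Orbit counting for an involution: twice the number of cycles is 4n plus the number of fixed
   points, here 4n + 2. *)
have := card_porbits s; rewrite s2 big_ord_recl big_ord1 /= expg1.
have -> : #|[set x | (s ^+ 0)%g x == x]| = (4 * n)%N.
  rewrite -[RHS](card_ord (4 * n)) -cardsT; congr #|pred_of_set _|.
  by apply/setP => x; rewrite !inE perm1 eqxx.
suff -> : #|[set x | s x == x]| = 2 by lia.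
pose t0 := ((n + 1) * k./2 %% (2 * n))%N.
have t0_lt : (t0 < 2 * n)%N by rewrite ltn_mod; lia.
have t0_lt4 : (t0 < 4 * n)%N by lia.
have t1_lt4 : (t0 + 2 * n < 4 * n)%N by lia.
transitivity #|[set Ordinal t0_lt4; Ordinal t1_lt4]|.
  congr #|pred_of_set _|; apply/setP => t; rewrite !inE sd_ba_fix // -!val_eqE /= -/t0.
  by apply: modn_eq_double => //; have := ltn_ord t; lia.
by rewrite cards2 -val_eqE /=; lia.
Qed.
End SemiDihedralGroup.

(** * Sums over residues modulo 4n *)

Lemma sum_parity (A : comPzRingType) (x y : A) (p : nat) :
  \sum_(k < 2 * p) (if odd k then x else y) = p%:R * (x + y).
Proof.
elim: p => [|p IHp]; first by rewrite muln0 big_ord0 mul0r.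
rewrite mulnS addnC addn2 !big_ord_recr /= IHp oddM /= mulrSr; ring.
Qed.

Section CharacterSums.
Variables (n : nat).
Hypotheses (n_ge2 : (2 <= n)%N) (n_even : ~~ odd n).

Let n4_gt0 : (0 < 4 * n)%N. Proof. by lia. Qed.
Let n2_lt : (2 * n < 4 * n)%N. Proof. by lia. Qed.

(** Negation modulo 4n; the outer reduction matters only at 0, which stays fixed. *)
Definition ord_neg (k : 'I_(4 * n)) : 'I_(4 * n) :=
  Ordinal (ltn_pmod (4 * n - k) n4_gt0).

Lemma ord_negE (k : 'I_(4 * n)) :
  ord_neg k = (if k == 0 :> nat then 0 else 4 * n - k)%N :> nat.
Proof.
rewrite /ord_neg; case: k => -[|k] kn /=; first by rewrite subn0 modnn.
by rewrite modn_small //; lia.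
Qed.

Lemma ord_neg_inj : injective ord_neg.
Proof.
move=> k l /(congr1 (@nat_of_ord _)); rewrite !ord_negE => E; apply: val_inj => /=.
move: E; have := ltn_ord k; have := ltn_ord l; do 2!case: ifP; lia.
Qed.

(** The residues 0 and 2n are fixed by negation. The other even residues form pairs k, 4n - k, and
    [C_even] contains the smaller member of each. *)
Lemma sum_even (A : comPzRingType) (F : nat -> A) :
  (forall k, (0 < k < 4 * n)%N -> F (4 * n - k)%N = F k) ->
  \sum_(k < 4 * n | ~~ odd k) F k
    = F 0%N + F (2 * n)%N + 2 * \sum_(k in C_even n) F k.
Proof.
move=> F_rev.
rewrite (bigD1 (Ordinal n4_gt0)) //= (bigD1 (Ordinal n2_lt)) /=; last first.
  by rewrite oddM -!val_eqE /=; lia.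
rewrite (bigID (fun k => k \in C_even n)) /= -addrA; congr (_ + (_ + _)).
rewrite mulr_natl mulr2n; congr (_ + _).
  by apply: eq_bigl => k; rewrite inE -!val_eqE /=; lia.
rewrite [LHS](reindex_inj ord_neg_inj); apply: eq_big => [k|k].
  rewrite !inE -!val_eqE /=; have := ord_negE k; rewrite /= => ->.
  by have := ltn_ord k; case: ifP; lia.
rewrite -!val_eqE /=; have := ord_negE k; rewrite /= => ->; case: eqP => //= /eqP k0 _.
by rewrite F_rev //; have := ltn_ord k; lia.
Qed.

(** Negation preserves the odd residues and changes the sign of each term, so the sum is its own
    opposite. *)
Lemma sum_odd_antisym (A : numDomainType) (F : nat -> A) :
  (forall k, (0 < k < 4 * n)%N -> odd k -> F (4 * n - k)%N = - F k) ->
  \sum_(k < 4 * n | odd k) F k = 0.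
Proof.
move=> F_rev; set S := (X in X = _).
have : S = - S.
  rewrite {1}/S (reindex_inj ord_neg_inj) -sumrN; apply: eq_big => [k|k] /=.
    by have := ord_negE k; rewrite /= => ->; have := ltn_ord k; case: ifP; lia.
  have := ord_negE k; rewrite /= => ->; have := ltn_ord k.
  case: eqP => // /eqP k0 kn k_odd; rewrite F_rev //; lia.
by move=> /eqP; rewrite -addr_eq0 -mulr2n mulrn_eq0 /= => /eqP.
Qed.

(** On odd residues multiplication by 2n - 1 is the reflection of each half: k goes to 2n - k below
    2n and to 6n - k above. As n is even, the centres n and 3n are not odd residues, and [C_odd] is
    the lower part of each half. *)
Lemma C_odd_obar : C_odd n :|: obar (C_odd n) = [set k : 'I_(4 * n) | odd k].
Proof.
have mulE (k : 'I_(4 * n)) : odd k ->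
    sd_mul k = (if k < 2 * n then 2 * n - k else 6 * n - k)%N :> nat.
  move=> k_odd /=; have := ltn_ord k => kn.
  (* For k = 2j + 1, 2nk = 4nj + 2n. *)
  have -> : ((2 * n - 1) * k = k./2 * (4 * n) + 2 * n - k)%N.
    have : k = (k./2 * 2 + 1)%N :> nat by lia.
    nia.
  have [k2|k2] := ltnP.
    by rewrite -addnBA ?modnMDl ?modn_small //; lia.
  have -> : (k./2 * (4 * n) + 2 * n - k = (k./2 - 1) * (4 * n) + (6 * n - k))%N by nia.
  by rewrite modnMDl modn_small //; lia.
apply/setP => k; rewrite in_setU inE /obar [in RHS]inE.
have -> : (k \in [set sd_mul x | x in C_odd n]) = (sd_mul k \in C_odd n).
  apply/imsetP/idP => [[x xC ->]|kC]; first by rewrite sd_mulK.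
  by exists (sd_mul k); rewrite ?sd_mulK.
have odd_mul (x : 'I_(4 * n)) : odd (sd_mul x) -> odd x.
  by rewrite /= odd_mod ?oddM //= => /andP[].
have [k_odd|k_even] := boolP (odd k); last first.
  apply/negbTE; rewrite negb_or; apply/andP; split => //.
  by rewrite inE; apply: contra k_even => /andP[/odd_mul].
rewrite !inE mulE //; have := ltn_ord k; case: ifP; lia.
Qed.
End CharacterSums.

(** * Dimensions for the individual characters *)

Section Dimensions.
Variables (R : realType) (n : nat) (V : vectType R[i]).
Hypotheses (n_ge2 : (2 <= n)%N) (n_even : ~~ odd n).

Local Notation a := (sd_a n).
Local Notation b := (sd_b n).
Local Notation m := (\dim {:V}).
Local Notation M k := (m%:R ^+ gcdn (4 * n) k).

Let n_neq0 : n%:R != 0 :> R. Proof. by rewrite pnatr_eq0; lia. Qed.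

Lemma complex_natX (d e : nat) : (d%:R ^+ e : R)%:C%C = d%:R ^+ e.
Proof. by rewrite rmorphXn rmorph_nat. Qed.

Lemma dim_sym_class_SD (chi : 'S_(4 * n) -> R[i]) : irr_character (SD n) chi ->
  (\dim (sym_class V (SD n) chi))%:R = chi 1%g / (8 * n)%:R *
    (\sum_(k < 4 * n) chi (a ^+ k)%g * M k +
     \sum_(k < 4 * n) chi (b * a ^+ k)%g *
       (if odd k then m%:R ^+ n else m%:R ^+ (2 * n + 1))).
Proof.
move=> irr; rewrite dim_sym_class //; last exact: pchar_num.
rewrite card_SD // big_SD //=; congr (_ * (_ + _)); apply: eq_bigr => k _.
  by rewrite card_porbits_sd_aX.
case: ifPn => k_odd; first by rewrite card_porbits_sd_baX_odd.
by rewrite card_porbits_sd_baX_even.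
Qed.

Lemma dim_sym_class_linear (u v : R) (chi : 'S_(4 * n) -> R[i]) :
  sd_linear u%:C%C v%:C%C chi ->
  (\dim (sym_class V (SD n) chi))%:R = (8 * n)%:R^-1 *
    (\sum_(k < 4 * n) u ^+ k * M k + v * \sum_(k < 4 * n) u ^+ k *
       (if odd k then m%:R ^+ n else m%:R ^+ (2 * n + 1))).
Proof.
move=> [lin chi_a chi_b]; have [irr chi1] := lin.
have chiM := linear_characterM (pchar_num _) lin.
have aG : a \in SD n by rewrite mem_gen // !inE eqxx.
have bG : b \in SD n by rewrite mem_gen // !inE eqxx orbT.
have chiX k : chi (a ^+ k)%g = (u ^+ k)%:C%C.
  elim: k => [|k IHk]; rewrite ?chi1 // expgSr exprSr chiM ?groupX //.
  by rewrite IHk chi_a rmorphM.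
(* The trace formula holds in [R[i]]; the values here are real, so injectivity of the embedding
   brings it back to [R]. *)
apply: complexI; rewrite rmorph_nat dim_sym_class_SD // chi1 mul1r.
rewrite rmorphM /= fmorphV rmorph_nat; congr (_ * _).
rewrite rmorphD rmorphM !rmorph_sum mulr_sumr /=.
congr (_ + _); apply: eq_bigr => k _.
  by rewrite chiX rmorphM /= complex_natX.
rewrite chiM ?groupX // chiX chi_b rmorphM /= mulrA; congr (_ * _).
by case: ifP => _; rewrite complex_natX.
Qed.

Lemma dim_sym_class_linear_1 (v : R) (chi : 'S_(4 * n) -> R[i]) :
  sd_linear 1 v%:C%C chi ->
  (\dim (sym_class V (SD n) chi))%:R = (8 * n)%:R^-1 *
    (\sum_(0 <= k < 4 * n) M k
     + v * (2 * n%:R * (m%:R ^+ n + m%:R ^+ (2 * n + 1)))).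
Proof.
rewrite -[1]/((1 : R)%:C%C) => /dim_sym_class_linear ->; congr (_ * (_ + v * _)).
  by rewrite big_mkord; apply: eq_bigr => k _; rewrite expr1n mul1r.
under eq_bigr => k _ do rewrite expr1n mul1r.
by rewrite -(natrM _ 2) (_ : 4 * n = 2 * (2 * n))%N ?sum_parity //; lia.
Qed.

Lemma gcdn_subr (N k : nat) : (k <= N)%N -> gcdn N (N - k) = gcdn N k.
Proof.
move=> /subnK; set A := (N - k)%N => <-.
by rewrite gcdnC gcdnDl [RHS]gcdnC gcdnDr gcdnC.
Qed.

Lemma gcdn_4n_2n : gcdn (4 * n) (2 * n) = (2 * n)%N.
Proof. by apply/gcdn_idPr/dvdnP; exists 2; lia. Qed.

(** The sign (-1)^k separates even from odd residues; the former fold onto [C_even], the latter are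
    [C_odd] with its image under [obar]. *)
Lemma dim_sym_class_linear_N1 (v : R) (chi : 'S_(4 * n) -> R[i]) :
  sd_linear (-1) v%:C%C chi ->
  (\dim (sym_class V (SD n) chi))%:R = (8 * n)%:R^-1 *
    (m%:R ^+ (4 * n) + m%:R ^+ (2 * n) + 2 * (\sum_(k in C_even n) M k)
     - (\sum_(k in C_odd n :|: obar (C_odd n)) M k)
     + v * (2 * n%:R * (m%:R ^+ (2 * n + 1) - m%:R ^+ n))).
Proof.
rewrite (_ : -1 = (-1 : R)%:C%C); last by rewrite rmorphN1.
move/dim_sym_class_linear ->; congr (_ * (_ + v * _)).
  rewrite C_odd_obar // (bigID (fun k : 'I__ => ~~ odd k)) /=; congr (_ + _).
    have := @sum_even _ n_ge2 n_even R (fun k => M k).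
    rewrite gcdn0 gcdn_4n_2n => <- => [|k k_bd].
      by apply: eq_bigr => k k_even; rewrite -signr_odd (negbTE k_even) mul1r.
    by rewrite gcdn_subr //; lia.
  rewrite -sumrN; apply: eq_big => [k|k]; first by rewrite inE negbK.
  by rewrite negbK => k_odd; rewrite -signr_odd k_odd mulN1r.
transitivity (\sum_(k < 4 * n)
  (if odd k then - m%:R ^+ n else m%:R ^+ (2 * n + 1)) : R).
  by apply: eq_bigr => k _; rewrite -signr_odd; case: odd; rewrite ?mulN1r ?mul1r.
rewrite -(natrM _ 2) (_ : 4 * n = 2 * (2 * n))%N ?sum_parity //; last lia.
by rewrite addrC.
Qed.

(** Replacing k by 4n - k negates the angle up to h full turns, so the cosine is symmetric and the
    sine antisymmetric. *)
Lemma angle_reflect (h k : nat) : (k <= 4 * n)%N ->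
  (h * (4 * n - k))%:R * pi / (2 * n)%:R
    = - ((h * k)%:R * pi / (2 * n)%:R) + (pi *+ 2) *+ h :> R.
Proof.
move=> k_le; rewrite !natrM natrB // natrM -[pi *+ 2]mulr_natl -[_ *+ h]mulr_natr.
by field.
Qed.

Lemma dim_sym_class_varsigma (h : nat) (chi : 'S_(4 * n) -> R[i]) :
  sd_varsigma h chi ->
  (\dim (sym_class V (SD n) chi))%:R = (2 * n)%:R^-1 *
    (\sum_(0 <= k < 4 * n) M k * cos ((h * k)%:R * pi / (2 * n)%:R)) :> R.
Proof.
move=> [irr chiE]; apply: complexI; rewrite rmorph_nat dim_sym_class_SD //.
rewrite [X in _ + X]big1 ?addr0 => [|k _]; last by rewrite (chiE k).2 mul0r.
have n4_gt0 : (0 < 4 * n)%N by lia.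
have -> : chi 1%g = 2.
  rewrite -(expg0 a) (chiE (Ordinal n4_gt0)).1 muln0 !mul0r cos0 mulr1.
  by rewrite rmorph_nat.
transitivity (2 / (8 * n)%:R *
    (2 * (\sum_(k < 4 * n) M k * cos ((h * k)%:R * pi / (2 * n)%:R))%:C) : R[i])%C.
  congr (_ * _); rewrite rmorph_sum mulr_sumr; apply: eq_bigr => k _.
  by rewrite (chiE k).1 !(rmorphM (real_complex R)) /= complex_natX rmorph_nat; ring.
rewrite big_mkord (rmorphM (real_complex R)) fmorphV rmorph_nat mulrA; congr (_ * _).
rewrite !natrM; field; by rewrite pnatr_eq0; lia.
Qed.

(** The imaginary values at odd k cancel in pairs, since the sine is antisymmetric and the gcd
    symmetric. The even k fold onto [C_even], apart from 0 and 2n. *)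
Lemma dim_sym_class_psi (h : nat) (chi : 'S_(4 * n) -> R[i]) : odd h ->
  sd_psi h chi ->
  (\dim (sym_class V (SD n) chi))%:R = (4 * n)%:R^-1 *
    (2 * m%:R ^+ (4 * n) - 2 * m%:R ^+ (2 * n)
     + 4 * (\sum_(k in C_even n) M k * cos ((h * k)%:R * pi / (2 * n)%:R))) :> R.
Proof.
move=> h_odd [irr chiE]; apply: complexI; rewrite rmorph_nat dim_sym_class_SD //.
rewrite [X in _ + X]big1 ?addr0 => [|k _]; last by rewrite (chiE k).2 mul0r.
have n4_gt0 : (0 < 4 * n)%N by lia.
have -> : chi 1%g = 2.
  rewrite -(expg0 a) (chiE (Ordinal n4_gt0)).1 /= muln0 !mul0r cos0 mulr1.
  by rewrite rmorph_nat.
pose F (k : nat) : R := M k * cos ((h * k)%:R * pi / (2 * n)%:R).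
pose S (k : nat) : R := M k * sin ((h * k)%:R * pi / (2 * n)%:R).
have S0 : \sum_(k < 4 * n | odd k) S k = 0.
  apply: sum_odd_antisym => // k k_bd _; rewrite /S gcdn_subr; last by lia.
  rewrite angle_reflect; last by lia.
  by rewrite (periodicn (@sinD2pi R)) sinN mulrN.
have F0 := @sum_even _ n_ge2 n_even R F.
rewrite (bigID (fun k : 'I__ => odd k)) /=.
transitivity (2 / (8 * n)%:R * ((2 * 'i * (\sum_(k < 4 * n | odd k) S k)%:C
    + 2 * (\sum_(k < 4 * n | ~~ odd k) F k)%:C)) : R[i])%C.
  congr (_ * (_ + _)); rewrite rmorph_sum mulr_sumr; apply: eq_bigr => k k_odd.
    rewrite (chiE k).1 k_odd (rmorphM (real_complex R)) /= complex_natX; ring.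
  rewrite (chiE k).1 (negbTE k_odd) !(rmorphM (real_complex R)) /=.
  by rewrite complex_natX rmorph_nat; ring.
rewrite S0 rmorph0 mulr0 add0r F0 => [|k k_bd]; last first.
  rewrite /F gcdn_subr; last by lia.
  rewrite angle_reflect; last by lia.
  by rewrite (periodicn (@cosD2pi R)) cosN.
have -> : F 0%N = m%:R ^+ (4 * n) by rewrite /F gcdn0 muln0 !mul0r cos0 mulr1.
have -> : F (2 * n)%N = - m%:R ^+ (2 * n).
  rewrite /F gcdn_4n_2n natrM mulrAC mulfK; last by rewrite pnatr_eq0; lia.
  (* At k = 2n the angle is h pi; for odd h it is pi up to full turns, whence the minus sign of
     m^(2n). *)
  have -> : h%:R * pi = pi + (pi *+ 2) *+ h./2 :> R.
    rewrite -{1}(odd_double_half h) h_odd natrD -muln2 natrM -[pi *+ 2]mulr_natl.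
    by rewrite -[_ *+ h./2]mulr_natr /=; ring.
  by rewrite (periodicn (@cosD2pi R)) cospi mulrN1.
set X := (X in X%:C%C).
(* The degree 2 and the factor 2 of the cosines give 4/(8n) = 2/(4n). *)
transitivity (((4 * n)%:R^-1 * (2 * X))%:C%C : R[i]).
  rewrite !(rmorphM (real_complex R)) fmorphV !rmorph_nat /= !natrM; field.
  by rewrite pnatr_eq0; lia.
congr (_ * _)%:C%C; rewrite /X; ring.
Qed.

End Dimensions.

Unset Implicit Arguments.
Set Strict Implicit.

(* The coefficients 2 of m^(4n) and m^(2n) in the last formula are those forced
   by the definitions; the source prints 1 for both. *)
Theorem theorem2p8 (R : realType) (n : nat) (n_ge2 : (2 <= n)%N)
    (n_even : ~~ odd n) (V : vectType R[i])
    (ip : {dot V for (@Num.conj R[i])}) (m : nat) (dimV : \dim {:V} = m)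
    (h h' : 'I_(4 * n)) (hE : h \in C_even n) (hO : h' \in C_odd n)
    (chi0 chi1 chi2 chi3 varsigma psi : 'S_(4 * n) -> R[i])
    (chi0P : sd_linear 1 1 chi0) (chi1P : sd_linear 1 (-1) chi1)
    (chi2P : sd_linear (-1) 1 chi2) (chi3P : sd_linear (-1) (-1) chi3)
    (varsigmaP : sd_varsigma h varsigma) (psiP : sd_psi h' psi) :
  let M (k : nat) : R := m%:R ^+ gcdn (4 * n) k in
  let dimS (chi : 'S_(4 * n) -> R[i]) : R :=
    (\dim (sym_class V (SD n) chi))%:R in
  (dimS chi0 = (8 * n)%:R^-1 *
     (2 * n%:R * m%:R ^+ n + 2 * n%:R * m%:R ^+ (2 * n + 1)
      + \sum_(0 <= k < 4 * n) M k)) /\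
  (dimS chi1 = (8 * n)%:R^-1 *
     (- (2 * n%:R * m%:R ^+ n) - 2 * n%:R * m%:R ^+ (2 * n + 1)
      + \sum_(0 <= k < 4 * n) M k)) /\
  (dimS chi2 = (8 * n)%:R^-1 *
     (m%:R ^+ (4 * n) + m%:R ^+ (2 * n) + 2 * (\sum_(k in C_even n) M k)
      - (\sum_(k in C_odd n :|: obar (C_odd n)) M k)
      + 2 * n%:R * m%:R ^+ (2 * n + 1) - 2 * n%:R * m%:R ^+ n)) /\
  (dimS chi3 = (8 * n)%:R^-1 *
     (m%:R ^+ (4 * n) + m%:R ^+ (2 * n) + 2 * (\sum_(k in C_even n) M k)
      - (\sum_(k in C_odd n :|: obar (C_odd n)) M k)
      - 2 * n%:R * m%:R ^+ (2 * n + 1) + 2 * n%:R * m%:R ^+ n)) /\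
  (dimS varsigma = (2 * n)%:R^-1 *
     (\sum_(0 <= k < 4 * n) M k * cos ((h * k)%:R * pi / (2 * n)%:R))) /\
  (dimS psi = (4 * n)%:R^-1 *
     (2 * m%:R ^+ (4 * n) - 2 * m%:R ^+ (2 * n)
      + 4 * (\sum_(k in C_even n) M k * cos ((h' * k)%:R * pi / (2 * n)%:R)))).
Proof.
have scalarN1 : (-1)%:C%C = -1 :> R[i] by rewrite rmorphN1.
have h'_odd : odd h' by move: hO; rewrite inE => /andP[].
(* Writes -1 as the image of a real number, the form of the coefficient [v] in the lemmas on linear
   characters. *)
rewrite -scalarN1 in chi1P chi3P.
rewrite /= -dimV; split; last split; last split; last split; last split.
- rewrite (dim_sym_class_linear_1 V n_ge2 n_even (v := 1) chi0P); congr (_ * _); ring.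
- rewrite (dim_sym_class_linear_1 V n_ge2 n_even chi1P); congr (_ * _); ring.
- rewrite (dim_sym_class_linear_N1 V n_ge2 n_even (v := 1) chi2P); congr (_ * _); ring.
(* Both values of [chi3] are -1, but only the one at [b] is to appear as an embedded real. *)
- rewrite scalarN1 in chi3P; rewrite -[X in sd_linear _ X]scalarN1 in chi3P.
  rewrite (dim_sym_class_linear_N1 V n_ge2 n_even chi3P); congr (_ * _); ring.
- exact: dim_sym_class_varsigma.
- exact: dim_sym_class_psi.
Qed.
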